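(* Let $Y_1\ne Y_2$ be rays in $V$. Then the family of nonempty basic loci $\mathrm{Loc}_T(Y_1,Y_2)$ of the interval $[Y_1,Y_2]$ ($T$ running through the basic types) is a partition of $\mathrm{Ray}(V)$ into convex subsets.
   Context: A supertropical semiring is a commutative semiring $R$ such that $e:=1+1$ satisfies $e+e=e$ and, for all $a,b\in R$: $a+b\in\{a,b\}$ if $ea\ne eb$, and $a+b=ea$ if $ea=eb$. Then $eR$ is a bipotent semiring with unit $e$, totally ordered by $a\le b\Leftrightarrow a+b=b$. Assume $eR$ is a semifield, and put $\mathcal G:=eR\setminus\{0\}$ (an ordered abelian group). $V$ is an $R$-module with a quadratic pair $(q,b)$: $q:V\to R$ with $q(ax)=a^2q(x)$, and $b:V\times V\to R$ symmetric bilinear with $q(x+y)=q(x)+q(y)+b(x,y)$. Assume $q$ is anisotropic: $q^{-1}(0)=\{0\}$. Rays: $x\sim x'$ in $V\setminus\{0\}$ iff $\lambda x=\mu x'$ for some $\lambda,\mu\in R\setminus\{0\}$; the classes are the rays, $\mathrm{ray}(x)$ is the class of $x$, and $\mathrm{Ray}(V)$ is the set of rays. For rays $X=\mathrm{ray}(x)$, $Y=\mathrm{ray}(y)$, the closed interval is $[X,Y]=\{\mathrm{ray}(\lambda x+\mu y)\mid \lambda,\mu\in R,\text{ not both }0\}$. A subset $A\subset\mathrm{Ray}(V)$ is convex if $[X,Y]\subset A$ for all $X,Y\in A$. The CS-ratio is $\mathrm{CS}(X,Y):=\dfrac{e\,b(x,y)^2}{e\,q(x)q(y)}\in eR$, which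 does not depend on the choice of $x\in X$, $y\in Y$. Basic types: for $Y_1\neq Y_2$, these are the following conditions on a ray $W$. Write $c_1=\mathrm{CS}(W,Y_1)$, $c_2=\mathrm{CS}(W,Y_2)$, $c_{12}=\mathrm{CS}(Y_1,Y_2)$. (1) Types which include the requirement $c_{12}>e$: $A$: $0<c_1<c_2/c_{12}$; $\partial A$: $0<c_1=c_2/c_{12}$; $B$: $0<c_2/c_{12}<c_1<c_2$; $\partial B$: $0<c_1=c_2$; $E$: $0=c_1<c_2$; $\partial E$: $0=c_1=c_2$; together with the reverse types $A',\partial A',B',E'$ obtained by interchanging $Y_1$ and $Y_2$ (the reverses of $\partial B$ and $\partial E$ are $\partial B$ and $\partial E$ themselves). (2) Types which include the requirement $c_{12}\le e$: $C$: $0<c_1<c_2$; $\partial C$: $0<c_1=c_2$; $D$: $0=c_1<c_2$; $\partial D$: $0=c_1=c_2$; together with the reverse types $C',D'$ obtained by interchanging $Y_1$ and $Y_2$ (the reverses of $\partial C,\partial D$ are themselves). For a basic type $T$, the basic locus $\mathrm{Loc}_T(Y_1,Y_2)$ is the set of all rays $W$ in $V$ satisfying condition $T$ (including the requirement on $c_{12}$). *)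

(* Defs.v *)
From mathcomp Require Import all_boot all_algebra.
From mathcomp Require Import boolp classical_sets.

Set Implicit Arguments.
Unset Strict Implicit.
Unset Printing Implicit Defensive.

Import GRing.Theory.

Local Open Scope classical_set_scope.
Local Open Scope ring_scope.

Section Supertropical.
Variable R : comPzSemiRingType.

Definition ghost_unit : R := 1 + 1.
Local Notation e := ghost_unit.

Record supertropical : Prop := Supertropical {
  ghost_unit_idem : e + e = e;
  addr_bipotent : forall a b : R, e * a <> e * b -> a + b = a \/ a + b = b;
  addr_ghost : forall a b : R, e * a = e * b -> a + b = e * a
}.

(* the ideal eR *)
Definition ghost : set R := range (fun a : R => e * a).

(* eR, whose unit element is e, is a semifield *)
Definition ghost_semifield : Prop :=
  e <> 0 /\
  forall a, ghost a -> a <> 0 -> exists2 c, ghost c & a * c = e.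

(* The relations below are the total ordering of eR; they are only used on
   elements of eR. *)
Definition gle (a b : R) : Prop := a + b = b.
Definition glt (a b : R) : Prop := gle a b /\ a <> b.

(* The quotient a / c in eR. For a, c in eR and c <> 0 it is the unique element
   d of eR with c * d = a, when eR is a semifield. *)
Definition gdiv (a c : R) : R := xget 0 [set d | ghost d /\ c * d = a].

End Supertropical.

Arguments ghost_unit {R}.

Section QuadraticPair.
Variables (R : comPzSemiRingType) (V : lSemiModType R).
Variables (q : V -> R) (b : V -> V -> R).

Record quadratic_pair : Prop := QuadraticPair {
  quadZ : forall (a : R) (x : V), q (a *: x) = a ^+ 2 * q x;
  quadD : forall x y : V, q (x + y) = q x + q y + b x y;
  bil_sym : forall x y : V, b x y = b y x;
  bilDl : forall x x' y : V, b (x + x') y = b x y + b x' y;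
  bilZl : forall (a : R) (x y : V), b (a *: x) y = a * b x y
}.

Definition anisotropic : Prop := q @^-1` [set 0] = [set 0].

End QuadraticPair.

Section Rays.
Variables (R : comPzSemiRingType) (V : lSemiModType R).

Definition ray_equiv (x x' : V) : Prop :=
  exists l m : R, [/\ l <> 0, m <> 0 & l *: x = m *: x'].

(* Rays are equivalence classes, hence sets of vectors. *)
Definition ray (x : V) : set V := [set x' | x' <> 0 /\ ray_equiv x x'].

Definition Ray : set (set V) := [set ray x | x in [set x : V | x <> 0]].

(* The vectors x and y range over all representatives of X and Y. *)
Definition interval (X Y : set V) : set (set V) :=
  [set Z | exists x y, [/\ X x, Y y & exists l m : R,
             ~ (l = 0 /\ m = 0) /\ Z = ray (l *: x + m *: y)]].

Definition convex (A : set (set V)) : Prop :=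
  A `<=` Ray /\ forall X Y, A X -> A Y -> interval X Y `<=` A.

End Rays.

Arguments Ray {R} V.

Section BasicLoci.
Variables (R : comPzSemiRingType) (V : lSemiModType R).
Variables (q : V -> R) (b : V -> V -> R).

Local Notation e := (@ghost_unit R).

Definition CS_vect (x y : V) : R :=
  gdiv (e * b x y ^+ 2) (e * (q x * q y)).

(* The CS-ratio of two rays is computed on chosen representatives; its value
   does not depend on the choice. *)
Definition CS (X Y : set V) : R := CS_vect (xget 0 X) (xget 0 Y).

(* The prefix d stands for the symbol of the boundary types, the suffix r for
   the prime of the reverse types. *)
Inductive basic_type : Type :=
  | tA | tdA | tB | tdB | tE | tdE | tAr | tdAr | tBr | tEr
  | tC | tdC | tD | tdD | tCr | tDr.

Definition condA (c1 c2 c12 : R) : Prop :=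
  [/\ glt e c12, glt 0 c1 & glt c1 (gdiv c2 c12)].
Definition conddA (c1 c2 c12 : R) : Prop :=
  [/\ glt e c12, glt 0 c1 & c1 = gdiv c2 c12].
Definition condB (c1 c2 c12 : R) : Prop :=
  [/\ glt e c12, glt 0 (gdiv c2 c12), glt (gdiv c2 c12) c1 & glt c1 c2].
Definition conddB (c1 c2 c12 : R) : Prop :=
  [/\ glt e c12, glt 0 c1 & c1 = c2].
Definition condE (c1 c2 c12 : R) : Prop :=
  [/\ glt e c12, 0 = c1 & glt c1 c2].
Definition conddE (c1 c2 c12 : R) : Prop :=
  [/\ glt e c12, 0 = c1 & c1 = c2].

Definition condC (c1 c2 c12 : R) : Prop :=
  [/\ gle c12 e, glt 0 c1 & glt c1 c2].
Definition conddC (c1 c2 c12 : R) : Prop :=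
  [/\ gle c12 e, glt 0 c1 & c1 = c2].
Definition condD (c1 c2 c12 : R) : Prop :=
  [/\ gle c12 e, 0 = c1 & glt c1 c2].
Definition conddD (c1 c2 c12 : R) : Prop :=
  [/\ gle c12 e, 0 = c1 & c1 = c2].

Definition basic_cond (T : basic_type) (Y1 Y2 W : set V) : Prop :=
  let direct (P : R -> R -> R -> Prop) := P (CS W Y1) (CS W Y2) (CS Y1 Y2) in
  let reverse (P : R -> R -> R -> Prop) := P (CS W Y2) (CS W Y1) (CS Y2 Y1) in
  match T with
  | tA => direct condA     | tAr => reverse condA
  | tdA => direct conddA   | tdAr => reverse conddA
  | tB => direct condB     | tBr => reverse condB
  | tdB => direct conddB
  | tE => direct condE     | tEr => reverse condE
  | tdE => direct conddE
  | tC => direct condC     | tCr => reverse condC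
  | tdC => direct conddC
  | tD => direct condD     | tDr => reverse condD
  | tdD => direct conddD
  end.

Definition Loc (T : basic_type) (Y1 Y2 : set V) : set (set V) :=
  [set W | Ray V W /\ basic_cond T Y1 Y2 W].

End BasicLoci.

(* Main.v *)
Require Import Defs.
From mathcomp Require Import all_boot all_algebra.
From mathcomp Require Import boolp classical_sets.

(** The partition property is trichotomy in the totally ordered semifield [eR].
For convexity, fix [y]: for [z = l x + m x'] the Frobenius identity
[(u + v)^2 = u^2 + v^2] in [eR] gives [CS(z, y) = a CS(x, y) + a' CS(x', y)],
where [a = e q(l x) / e q(z)] and [a' = e q(m x') / e q(z)] do not depend on
[y] and are not both zero. For fixed [c12] each basic type is a system of
homogeneous linear equations and strict inequalities in [(c1, c2)], and all of
these are stable under such combinations. *)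

Local Open Scope classical_set_scope.
Local Open Scope ring_scope.

Import GRing.Theory.

(** * The totally ordered semiring [eR], in which a sum is a maximum *)

Section GhostOrder.
Set Implicit Arguments.
Unset Strict Implicit.
Variable R : comPzSemiRingType.
Hypothesis hR : supertropical R.
Hypothesis hG : ghost_semifield R.
Local Notation e := (@ghost_unit R).
Implicit Types a b c d u v x y : R.

Lemma ghost_unitM : e * e = e.
Proof. by rewrite {1}/ghost_unit mulrDl !mul1r ghost_unit_idem. Qed.

Lemma ghost_unit_neq0 : e <> 0.
Proof. by case: hG. Qed.

Lemma ghostMl a : ghost (e * a).
Proof. by exists a. Qed.

Lemma ghost_ghost_unit : ghost e.
Proof. by rewrite -(mulr1 e); exact: ghostMl. Qed.

Lemma ghostE a : ghost a -> e * a = a.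
Proof. by case=> c _ <-; rewrite mulrA ghost_unitM. Qed.

Lemma ghostM a x : ghost a -> ghost (a * x).
Proof. by case=> c _ <-; rewrite -mulrA; exact: ghostMl. Qed.

Lemma ghostD a c : ghost a -> ghost c -> ghost (a + c).
Proof. by move=> [x _ <-] [y _ <-]; rewrite -mulrDr; exact: ghostMl. Qed.

Lemma ghost0 : ghost (0 : R).
Proof. by rewrite -(mulr0 e); exact: ghostMl. Qed.

Lemma ghost_addxx a : ghost a -> a + a = a.
Proof. by move=> ha; rewrite addr_ghost // ghostE. Qed.

Lemma ghost_total a c : ghost a -> ghost c -> gle a c \/ gle c a.
Proof.
move=> ha hc; have [->|/eqP ac] := eqVneq a c; first by left; exact: ghost_addxx.
have [|h|h] := addr_bipotent hR (a := a) (b := c); first by rewrite !ghostE.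
- by right; rewrite /gle addrC.
- by left.
Qed.

Lemma gle_anti a c : gle a c -> gle c a -> a = c.
Proof. by rewrite /gle addrC => -> . Qed.

(** If [u <= v], then [u * v + v * v = (u + v) * v = v * v], so the mixed term is absorbed by the
    square of the larger element. *)
Lemma ghost_sqrD a c : ghost a -> ghost c -> (a + c) ^+ 2 = a ^+ 2 + c ^+ 2.
Proof.
have half u v : gle u v -> (u + v) ^+ 2 = u ^+ 2 + v ^+ 2.
  move=> uv; rewrite uv !expr2 -{1}uv mulrDl -{1}uv mulrDr -addrA -mulrDl.
  by rewrite uv.
by move=> ha hc; case: (ghost_total ha hc) => /half //; rewrite addrC (addrC (c ^+ 2)).
Qed.

(** [a] and [0] then have the same ghost, so the supertropical axiom gives [a = a + 0 = e * a]. *)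
Lemma ghost_eq0 a : e * a = 0 -> a = 0.
Proof.
by move=> h; rewrite -[LHS]addr0 (addr_ghost hR) // mulr0.
Qed.

(** In [eR] the sum is the larger summand and [0] is the least element, so nothing can cancel;
    [ghost_eq0] lifts this back to [R]. *)
Lemma ghost_addr_eq0 a c : e * (a + c) = 0 -> a = 0 /\ c = 0.
Proof.
rewrite mulrDr => h.
case: (ghost_total (ghostMl a) (ghostMl c)) => le.
- have c0 : e * c = 0 by rewrite -le.
  by move: h; rewrite c0 addr0 => /ghost_eq0 ->; rewrite (ghost_eq0 c0).
- have a0 : e * a = 0 by rewrite -le addrC.
  by move: h; rewrite a0 add0r => /ghost_eq0 ->; rewrite (ghost_eq0 a0).
Qed.

(** * Cancellation and division in the semifield [eR] *)

Lemma ghost_mulI a x y : ghost a -> a <> 0 -> ghost x -> ghost y ->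
  a * x = a * y -> x = y.
Proof.
move=> ha a0 hx hy h; case: hG => _ /(_ a ha a0) [c _ ac].
by rewrite -(ghostE hx) -(ghostE hy) -ac mulrAC h mulrAC.
Qed.

(** Passing to ghosts loses no information about vanishing, and nonzero elements of [eR] can be
    cancelled. *)
Lemma mulr_neq0 x y : x <> 0 -> y <> 0 -> x * y <> 0.
Proof.
move=> x0 y0 xy; apply: y0; apply: ghost_eq0.
apply: (@ghost_mulI (e * x)); [exact: ghostMl| |exact: ghostMl|exact: ghost0|].
  by move/ghost_eq0.
by rewrite mulr0 mulrACA ghost_unitM xy mulr0.
Qed.

Lemma gdivP a c : ghost c -> c <> 0 -> ghost a ->
  ghost (gdiv a c) /\ c * gdiv a c = a.
Proof.
move=> hc c0 ha; rewrite /gdiv; case: xgetP => [d _ []//|none].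
case: hG => _ /(_ c hc c0) [d hd cd].
by case: (none (d * a)); split; [exact: ghostM|rewrite mulrA cd ghostE].
Qed.

Lemma gdiv_eq a c d : ghost c -> c <> 0 -> ghost d -> c * d = a -> gdiv a c = d.
Proof.
move=> hc c0 hd cd.
have ha : ghost a by rewrite -cd; exact: ghostM.
have [hq cq] := gdivP hc c0 ha.
by apply: (ghost_mulI hc c0) => //; rewrite cq.
Qed.

(** The default value [0] of [xget] lies in [eR] as well. *)
Lemma ghost_gdiv a c : ghost (gdiv a c).
Proof. by rewrite /gdiv; case: xgetP => [d _ []//|_]; exact: ghost0. Qed.

(** * The strict order and its stability under linear combinations *)

Lemma glt0P a : glt 0 a <-> a <> 0.
Proof.
by split=> [[_ /nesym]//|a0]; split; [rewrite /gle add0r|exact: nesym].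
Qed.

(** A bundle of rewrite rules that settles the boolean tests of [type_of] from one strict
    inequality. *)
Lemma glt_eqs a c : glt a c ->
  (((a == c) = false) * ((c == a) = false)) *
  (((a + c == c) = true) * ((c + a == a) = false)).
Proof.
move=> [le /eqP/negPf ne]; rewrite [c == a]eq_sym ne le eqxx; split=> //; split=> //.
by rewrite addrC le eq_sym.
Qed.

Lemma ghost_ltP a c : ghost a -> ghost c -> [\/ glt a c, a = c | glt c a].
Proof.
move=> ha hc; have [->|/eqP ac] := eqVneq a c; first by constructor 2.
by case: (ghost_total ha hc) => h; [constructor 1|constructor 3; split=> // /esym].
Qed.

Lemma glt_trans a c d : glt a c -> glt c d -> glt a d.
Proof.
move=> [ac nac] [cd ncd]; split; first by rewrite /gle -cd addrA ac.
by move=> ad; apply: ncd; apply: gle_anti => //; rewrite -ad.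
Qed.

Lemma gleNlt a c : ghost a -> ghost c -> ~ glt a c <-> gle c a.
Proof.
move=> ha hc; split=> [n|ca [ac nac]]; last by apply: nac; exact: gle_anti.
by case: (ghost_ltP ha hc) => [//|->|[]//]; exact: ghost_addxx.
Qed.

Lemma glt_mulr a x y : ghost a -> a <> 0 -> ghost x -> ghost y -> glt x y ->
  glt (a * x) (a * y).
Proof.
move=> ha a0 hx hy [le ne]; split; first by rewrite /gle -mulrDr le.
by move=> h; apply: ne; exact: ghost_mulI h.
Qed.

(** Adding the same term to both sides may destroy strictness. With two strict inequalities it
    survives: [y + v] is the larger of [y] and [v], and both [x] and [u] lie strictly below it. *)
Lemma glt_add x y u v : ghost x -> ghost y -> ghost u -> ghost v ->
  glt x y -> glt u v -> glt (x + u) (y + v).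
Proof.
have half (s t s' t' : R) : ghost s -> ghost s' -> gle t' t ->
    glt s t -> glt s' t' -> glt (s + s') (t + t').
  move=> hs hs' tt st st'.
  have -> : t + t' = t by rewrite addrC tt.
  case: (ghost_total hs hs') => [->|le]; last by rewrite addrC le.
  split; first by rewrite /gle -tt addrA; case: st' => ->.
  move=> st0; case: st' => le' ne'; apply: ne'; apply: gle_anti => //.
  by rewrite st0.
move=> hx hy hu hv xy uv; case: (ghost_total hy hv) => h.
  by rewrite (addrC x) (addrC y); exact: half.
exact: half.
Qed.

(** A zero coefficient would make its own inequality an equality, so its summand is dropped; the
    other coefficient is then nonzero and preserves strictness. *)
Lemma glt_comb a a' x y x' y' : ghost a -> ghost a' -> ~ (a = 0 /\ a' = 0) ->
  ghost x -> ghost y -> ghost x' -> ghost y' -> glt x y -> glt x' y' ->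
  glt (a * x + a' * x') (a * y + a' * y').
Proof.
move=> ha ha' nz hx hy hx' hy' xy xy'.
have [a0|/eqP a0] := eqVneq a 0; have [a0'|/eqP a0'] := eqVneq a' 0.
- by case: nz.
- by rewrite a0 !mul0r !add0r; exact: glt_mulr.
- by rewrite a0' !mul0r !addr0; exact: glt_mulr.
- by apply: glt_add; try exact: ghostM; exact: glt_mulr.
Qed.

(** This makes the conditions on [c2 / c12] linear in [(c1, c2)] once [c12] is fixed. *)
Lemma gdiv_comb a a' x x' c : ghost c -> c <> 0 -> ghost x -> ghost x' ->
  gdiv (a * x + a' * x') c = a * gdiv x c + a' * gdiv x' c.
Proof.
move=> hc c0 hx hx'; have [hd cd] := gdivP hc c0 hx.
have [hd' cd'] := gdivP hc c0 hx'.
apply: gdiv_eq => //; last by rewrite mulrDr !(mulrCA c) cd cd'.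
by apply: ghostD; rewrite mulrC; exact: ghostM.
Qed.

Lemma glt_ghost_unit_neq0 c : glt e c -> c <> 0.
Proof. by move=> [+ _] c0; rewrite c0 /gle addr0; exact: ghost_unit_neq0. Qed.

Lemma gdiv0 c : ghost c -> c <> 0 -> gdiv 0 c = 0.
Proof. by move=> hc c0; apply: gdiv_eq => //; [exact: ghost0|rewrite mulr0]. Qed.

Lemma gdiv_neq0 x c : ghost c -> c <> 0 -> ghost x -> x <> 0 -> gdiv x c <> 0.
Proof. by move=> hc c0 hx x0 d0; have [_] := gdivP hc c0 hx; rewrite d0 mulr0 => /esym. Qed.

Lemma gdiv_glt x c : ghost c -> glt e c -> ghost x -> x <> 0 ->
  glt (gdiv x c) x.
Proof.
move=> hc ec hx x0; have c0 := glt_ghost_unit_neq0 ec.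
have [hd cd] := gdivP hc c0 hx.
rewrite -{2}cd -{1}(ghostE hd) !(mulrC _ (gdiv x c)).
apply: glt_mulr => //; first exact: gdiv_neq0.
exact: ghost_ghost_unit.
Qed.

(** * The basic types as conditions on three elements of [eR] *)

Definition type_cond (T : basic_type) (c1 c2 c12 : R) : Prop :=
  match T with
  | tA => condA c1 c2 c12   | tAr => condA c2 c1 c12
  | tdA => conddA c1 c2 c12 | tdAr => conddA c2 c1 c12
  | tB => condB c1 c2 c12   | tBr => condB c2 c1 c12
  | tdB => conddB c1 c2 c12
  | tE => condE c1 c2 c12   | tEr => condE c2 c1 c12
  | tdE => conddE c1 c2 c12
  | tC => condC c1 c2 c12   | tCr => condC c2 c1 c12
  | tdC => conddC c1 c2 c12
  | tD => condD c1 c2 c12   | tDr => condD c2 c1 c12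
  | tdD => conddD c1 c2 c12
  end.

(** A decision tree that recovers the type from the three values. Two types satisfied by the same
    triple both equal its output, which replaces a comparison of all pairs of types. The test
    [large] expresses [c12 > e] as the failure of [c12 <= e]. *)
Definition type_of (c1 c2 c12 : R) : basic_type :=
  let large := c12 + e != e in
  if c1 == 0 then
    if c2 == 0 then if large then tdE else tdD else if large then tE else tD
  else if c2 == 0 then if large then tEr else tDr
  else if c1 == c2 then if large then tdB else tdC
  else if c1 + c2 == c2 then
    if ~~ large then tC
    else if c1 == gdiv c2 c12 then tdA
    else if c1 + gdiv c2 c12 == gdiv c2 c12 then tA else tB
  else
    if ~~ large then tCr
    else if c2 == gdiv c1 c12 then tdAr
    else if c2 + gdiv c1 c12 == gdiv c1 c12 then tAr else tBr.

(** Successive case distinctions: [c12] against [e], vanishing of [c1] and [c2], then [c1] against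
    [c2]; for [c12 > e] the smaller one is finally compared with the larger one divided by [c12]. *)
Lemma type_cond_exists c1 c2 c12 : ghost c1 -> ghost c2 -> ghost c12 ->
  exists T, type_cond T c1 c2 c12.
Proof.
move=> h1 h2 h12; have he := ghost_ghost_unit; have h0 := ghost0.
have pos x : x <> 0 -> glt 0 x by move/glt0P.
case: (EM (glt e c12)) => [big|/(gleNlt he h12) small].
- have c0 := glt_ghost_unit_neq0 big.
  have [z1|/eqP z1] := eqVneq c1 0; have [z2|/eqP z2] := eqVneq c2 0.
  + by exists tdE; split; rewrite ?z1 ?z2.
  + by exists tE; split; rewrite ?z1 //; exact: pos.
  + by exists tEr; split; rewrite ?z2 //; exact: pos.
  have [p1 p2] := (pos _ z1, pos _ z2).
  case: (ghost_ltP h1 h2) => [lt|eq|lt].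
  + case: (ghost_ltP h1 (ghost_gdiv c2 c12)) => k;
      [by exists tA|by exists tdA|exists tB].
    (* Only type [tB] is left; its lower bound [0 < c2 / c12] comes from [c2 <> 0]. *)
    by split=> //; apply: pos; exact: gdiv_neq0.
  + by exists tdB.
  + case: (ghost_ltP h2 (ghost_gdiv c1 c12)) => k;
      [by exists tAr|by exists tdAr|exists tBr].
    by split=> //; apply: pos; exact: gdiv_neq0.
- have [z1|/eqP z1] := eqVneq c1 0; have [z2|/eqP z2] := eqVneq c2 0.
  + by exists tdD; split; rewrite ?z1 ?z2.
  + by exists tD; split; rewrite ?z1 //; exact: pos.
  + by exists tDr; split; rewrite ?z2 //; exact: pos.
  have [p1 p2] := (pos _ z1, pos _ z2).
  by case: (ghost_ltP h1 h2) => k; [exists tC|exists tdC|exists tCr].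
Qed.

Lemma type_cond_type_of T c1 c2 c12 : ghost c1 -> ghost c2 -> ghost c12 ->
  type_cond T c1 c2 c12 -> type_of c1 c2 c12 = T.
Proof.
move=> h1 h2 h12.
have large : glt e c12 -> (c12 + e == e) = false by move/glt_eqs=> ->.
have small : gle c12 e -> (c12 + e == e) = true by move=> ->; rewrite eqxx.
have posE x : glt 0 x -> (x == 0) = false by move/glt_eqs=> ->.
(* Types A and dA do not state [c1 < c2], but the tree tests it. It follows from
   [c1 <= c2 / c12 < c2], as [c12 > e]; here [c2 = 0] is excluded since it would force [c1 <= 0]. *)
have divlt x y : ghost x -> glt e c12 -> glt 0 y ->
    glt y (gdiv x c12) \/ y = gdiv x c12 -> glt 0 x /\ glt y x.
  move=> hx big py yd; have c0 := glt_ghost_unit_neq0 big.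
  have x0 : x <> 0.
    move=> x0; move: yd; rewrite x0 gdiv0 // => -[[]|].
      by rewrite /gle addr0.
    by case: py => _ /nesym.
  split; first exact/glt0P.
  have dx := gdiv_glt h12 big hx x0.
  by case: yd => [yd|->//]; exact: glt_trans yd dx.
rewrite /type_of; case: T => /= -[].
- move=> b p k; have [p2 lt] := divlt _ _ h2 b p (or_introl k).
  by rewrite large // !posE // !(glt_eqs lt) !(glt_eqs k).
- move=> b p k; have [p2 lt] := divlt _ _ h2 b p (or_intror k).
  by rewrite large // !posE // !(glt_eqs lt) -k eqxx.
- move=> b p k lt; have p1 := glt_trans p k; have p2 := glt_trans p1 lt.
  by rewrite large // !posE // !(glt_eqs lt) !(glt_eqs k).
- by move=> b p <-; rewrite large // !posE // eqxx.
- by move=> b <- p; rewrite large // eqxx posE.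
- by move=> b <- <-; rewrite large // eqxx.
- move=> b p k; have [p2 lt] := divlt _ _ h1 b p (or_introl k).
  by rewrite large // !posE // !(glt_eqs lt) !(glt_eqs k).
- move=> b p k; have [p2 lt] := divlt _ _ h1 b p (or_intror k).
  by rewrite large // !posE // !(glt_eqs lt) -k eqxx.
- move=> b p k lt; have p1 := glt_trans p k; have p2 := glt_trans p1 lt.
  by rewrite large // !posE // !(glt_eqs lt) !(glt_eqs k).
- by move=> b <- p; rewrite large // eqxx posE.
- by move=> b p lt; have p2 := glt_trans p lt; rewrite small // !posE // !(glt_eqs lt).
- by move=> b p <-; rewrite small // !posE // eqxx.
- by move=> b <- p; rewrite small // eqxx posE.
- by move=> b <- <-; rewrite small // eqxx.
- by move=> b p lt; have p2 := glt_trans p lt; rewrite small // !posE // !(glt_eqs lt).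
- by move=> b <- p; rewrite small // eqxx posE.
Qed.

Lemma type_cond_comb T a a' c1 c2 c1' c2' c12 :
  ghost a -> ghost a' -> ~ (a = 0 /\ a' = 0) ->
  ghost c1 -> ghost c2 -> ghost c1' -> ghost c2' -> ghost c12 ->
  type_cond T c1 c2 c12 -> type_cond T c1' c2' c12 ->
  type_cond T (a * c1 + a' * c1') (a * c2 + a' * c2') c12.
Proof.
move=> ha ha' nz h1 h2 h1' h2' h12.
have lt x y x' y' := @glt_comb a a' x y x' y' ha ha' nz.
have pos x x' : ghost x -> ghost x' -> glt 0 x -> glt 0 x' ->
    glt 0 (a * x + a' * x').
  move=> hx hx' p p'; have := lt 0 x 0 x' ghost0 hx ghost0 hx' p p'.
  by rewrite !mulr0 addr0.
have dv x x' : ghost x -> ghost x' -> glt e c12 ->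
    gdiv (a * x + a' * x') c12 = a * gdiv x c12 + a' * gdiv x' c12.
  by move=> hx hx' /glt_ghost_unit_neq0 c0; exact: gdiv_comb.
have hd := ghost_gdiv.
(* Closes the equations [0 = c1] of types E and D and their relatives after substitution. *)
have zero : 0 = a * 0 + a' * 0 by rewrite !mulr0 addr0.
case: T => /=.
- by move=> [b p k] [_ p' k']; split; rewrite ?dv //; [exact: pos|exact: lt].
- by move=> [b p k] [_ p' k']; split; rewrite ?dv -?k -?k' //; exact: pos.
- by move=> [b p k l] [_ p' k' l']; split; rewrite ?dv //;
    [exact: pos|exact: lt|exact: lt].
- by move=> [b p <-] [_ p' <-]; split=> //; exact: pos.
- by move=> [b <- p] [_ <- p']; split=> //; exact: lt ghost0 _ ghost0 _ _ _.
- by move=> [b <- <-] [_ <- <-]; split.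
- by move=> [b p k] [_ p' k']; split; rewrite ?dv //; [exact: pos|exact: lt].
- by move=> [b p k] [_ p' k']; split; rewrite ?dv -?k -?k' //; exact: pos.
- by move=> [b p k l] [_ p' k' l']; split; rewrite ?dv //;
    [exact: pos|exact: lt|exact: lt].
- by move=> [b <- p] [_ <- p']; split=> //; exact: lt ghost0 _ ghost0 _ _ _.
- by move=> [b p k] [_ p' k']; split=> //; [exact: pos|exact: lt].
- by move=> [b p <-] [_ p' <-]; split=> //; exact: pos.
- by move=> [b <- p] [_ <- p']; split=> //; exact: lt ghost0 _ ghost0 _ _ _.
- by move=> [b <- <-] [_ <- <-]; split.
- by move=> [b p k] [_ p' k']; split=> //; [exact: pos|exact: lt].
- by move=> [b <- p] [_ <- p']; split=> //; exact: lt ghost0 _ ghost0 _ _ _.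
Qed.

End GhostOrder.

(** * Rays, their representatives and the CS-ratio *)

Section RayRatio.
Set Implicit Arguments.
Unset Strict Implicit.
Variables (R : comPzSemiRingType) (V : lSemiModType R).
Variables (q : V -> R) (b : V -> V -> R).
Hypotheses (hR : supertropical R) (hG : ghost_semifield R).
Hypotheses (hqb : quadratic_pair q b) (hq : anisotropic q).
Local Notation e := (@ghost_unit R).
Implicit Types (x y z : V) (W X Y Z : set V).

Lemma anisotropicP x : q x = 0 <-> x = 0.
Proof.
have E : (q @^-1` [set 0]) x = [set 0] x by rewrite hq.
by split=> h; [rewrite -[_ = _]/([set 0] x) -E|rewrite -[_ = _]/((q @^-1` [set 0]) x) E].
Qed.

(** By anisotropy and [q (l *: x) = l ^+ 2 * q x], the absence of zero divisors passes from [R] to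
    [V]. *)
Lemma scaler_neq0 (l : R) x : l <> 0 -> x <> 0 -> l *: x <> 0.
Proof.
move=> l0 x0 /anisotropicP; rewrite (quadZ hqb) expr2 => /mulr_neq0; apply=> //.
- exact: mulr_neq0.
- by move/anisotropicP.
Qed.

(** [q x] and [q y] are summands of [q (x + y)], and a vanishing sum in [R] has vanishing
    summands. *)
Lemma addv_eq0 x y : x + y = 0 -> x = 0 /\ y = 0.
Proof.
move/anisotropicP; rewrite (quadD hqb) => h.
have [] := @ghost_addr_eq0 _ hR (q x + q y) (b x y); first by rewrite h mulr0.
move=> h' _; have [] := @ghost_addr_eq0 _ hR (q x) (q y); first by rewrite h' mulr0.
by move=> /anisotropicP -> /anisotropicP ->.
Qed.

Lemma ray_equiv_sym x y : ray_equiv x y -> ray_equiv y x.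
Proof. by move=> [l [m [l0 m0 h]]]; exists m, l; split. Qed.

Lemma ray_equiv_trans x y z : ray_equiv x y -> ray_equiv y z -> ray_equiv x z.
Proof.
move=> [l [m [l0 m0 h]]] [l' [m' [l0' m0' h']]].
exists (l' * l), (m * m'); split; [exact: mulr_neq0..|].
by rewrite -scalerA h scalerA mulrC -!scalerA h'.
Qed.

Lemma ray_refl x : x <> 0 -> ray x x.
Proof.
move=> x0; split=> //; exists e, e; split=> //; exact: ghost_unit_neq0.
Qed.

Lemma Ray_mem W x : Ray V W -> W x -> x <> 0 /\ W = ray x.
Proof.
move=> [w w0 <-] [x0 wx]; split=> //; apply/seteqP; split=> y [y0 h]; split=> //.
- exact: ray_equiv_trans (ray_equiv_sym wx) h.
- exact: ray_equiv_trans wx h.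
Qed.

(** Rays are nonempty, so the default value [0] of [xget] is never taken and [CS] is computed on
    true representatives. *)
Lemma xget_Ray W : Ray V W -> W (xget 0 W).
Proof. by move=> [w w0 <-]; exact: xgetPex (ex_intro _ w (ray_refl w0)). Qed.

Lemma ghost_CS X Y : ghost (CS q b X Y).
Proof. exact: ghost_gdiv. Qed.

Lemma CS_sym X Y : CS q b X Y = CS q b Y X.
Proof. by rewrite /CS /CS_vect (bil_sym hqb) (mulrC (q _)). Qed.

Lemma quad_prod_neq0 x y : x <> 0 -> y <> 0 -> e * (q x * q y) <> 0.
Proof.
move=> x0 y0; apply: mulr_neq0 => //; first exact: ghost_unit_neq0.
by apply: mulr_neq0 => // /anisotropicP.
Qed.

Lemma CS_vectP x y : x <> 0 -> y <> 0 ->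
  e * (q x * q y) * CS_vect q b x y = e * b x y ^+ 2.
Proof.
move=> x0 y0.
by have [] := gdivP hR hG (ghostMl _) (quad_prod_neq0 x0 y0) (ghostMl (b x y ^+ 2)).
Qed.

(** Numerator and denominator both acquire the factor [l ^+ 2]. *)
Lemma CS_vectZ (l : R) x y : l <> 0 -> x <> 0 -> y <> 0 ->
  CS_vect q b (l *: x) y = CS_vect q b x y.
Proof.
move=> l0 x0 y0; apply: gdiv_eq => //; [exact: ghostMl| |exact: ghost_gdiv|].
  by apply: quad_prod_neq0 => //; exact: scaler_neq0.
rewrite (quadZ hqb) (bilZl hqb) exprMn_comm; last exact: mulrC.
by rewrite [RHS]mulrCA -CS_vectP // -!mulrA !(mulrCA e l).
Qed.

(** Any representative of the first ray may be used, since two of them have a common nonzero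
    multiple. This lets a ray of an interval be represented by the linear combination defining
    it. *)
Lemma CS_mem W Y x : Ray V W -> W x -> Ray V Y ->
  CS q b W Y = CS_vect q b x (xget 0 Y).
Proof.
move=> hW Wx hY; rewrite /CS.
have [x0 WE] := Ray_mem hW Wx.
have [y0 _] := Ray_mem hY (xget_Ray hY).
have [] : ray x (xget 0 W) by rewrite -WE; exact: xget_Ray.
move: (xget 0 W) (xget 0 Y) y0 => w y y0 w0 [l [m [l0 m0 h]]].
by rewrite -(CS_vectZ m0 w0 y0) -h CS_vectZ.
Qed.

(** * The CS-ratio of a sum of vectors *)

Definition weight x z : R := gdiv (e * q x) (e * q z).

Lemma weight_ghost x z : ghost (weight x z).
Proof. exact: ghost_gdiv. Qed.

Lemma ghost_quad_neq0 z : z <> 0 -> e * q z <> 0.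
Proof. by move=> z0 /(ghost_eq0 hR)/anisotropicP. Qed.

Lemma mul_weight x z : z <> 0 -> e * q z * weight x z = e * q x.
Proof.
by move=> /ghost_quad_neq0 z0; have [] := gdivP hR hG (ghostMl _) z0 (ghostMl (q x)).
Qed.

Lemma weight_eq0 x z : z <> 0 -> weight x z = 0 <-> x = 0.
Proof.
move=> z0; have wP := mul_weight x z0; split=> [w0|x0].
  by apply/anisotropicP; apply: (ghost_eq0 hR); rewrite -wP w0 mulr0.
move/anisotropicP: x0 => x0; rewrite /weight x0 mulr0.
by apply: gdiv0 => //; [exact: ghostMl|exact: ghost_quad_neq0].
Qed.

(** The factor [q x] in the denominator of the CS-ratio cancels against the weight, so that
    [q z * q y] becomes a denominator common to all summands of [z]. *)
Lemma weight_CS x y z : z <> 0 -> y <> 0 ->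
  e * (q z * q y) * (weight x z * CS_vect q b x y) = e * b x y ^+ 2.
Proof.
(* For [x = 0] the CS-ratio has denominator [0] and carries no information; the weight [0]
   annihilates it, while [b x y] vanishes because [0] can be written [0 *: y]. *)
move=> z0 y0; have [x0|/eqP x0] := eqVneq x 0.
  move/(weight_eq0 _ z0): (x0) ->; rewrite x0 -(scale0r y) (bilZl hqb).
  by rewrite !(mul0r, mulr0) expr2 !mulr0.
rewrite -CS_vectP // mulrA; congr (_ * _).
by rewrite mulrA mulrAC mul_weight // mulrA.
Qed.

(** After multiplication by the common denominator, the claim is additivity of [e * b x y ^+ 2] in
    [x], which is the Frobenius identity. *)
Lemma CS_vectD x x' y : x + x' <> 0 -> y <> 0 ->
  CS_vect q b (x + x') y = weight x (x + x') * CS_vect q b x y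
                         + weight x' (x + x') * CS_vect q b x' y.
Proof.
move=> z0 y0; apply: gdiv_eq => //.
- exact: ghostMl.
- exact: quad_prod_neq0.
- by apply: ghostD; apply: ghostM; exact: weight_ghost.
(* The Frobenius identity is available in [eR], so [e] is moved inside the square, using
   [e * e = e]. *)
have sqr u : e * u ^+ 2 = (e * u) ^+ 2.
  by rewrite !expr2 mulrACA ghost_unitM.
rewrite mulrDr !weight_CS // (bilDl hqb) !sqr mulrDr ghost_sqrD //; exact: ghostMl.
Qed.

(** The coefficients are quantified before [Y], since the ratios to [Y1] and to [Y2] must be
    combined with the same ones. *)
Lemma CS_interval X X' Z : Ray V X -> Ray V X' -> Defs.interval X X' Z ->
  Ray V Z /\ exists a a' : R, [/\ ghost a, ghost a', ~ (a = 0 /\ a' = 0) &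
    forall Y, Ray V Y -> CS q b Z Y = a * CS q b X Y + a' * CS q b X' Y].
Proof.
move=> hX hX' [x [x' [Xx Xx' [l [m [lm ZE]]]]]].
have [x0 _] := Ray_mem hX Xx; have [x0' _] := Ray_mem hX' Xx'.
have coef0 (k : R) (u : V) : u <> 0 -> k *: u = 0 -> k = 0.
  by move=> u0 ku; have [//|/eqP k0] := eqVneq k 0; have := scaler_neq0 k0 u0 ku.
set z := l *: x + m *: x' in ZE.
have z0 : z <> 0.
  by move=> /addv_eq0[/coef0 l0 /coef0 m0]; apply: lm; split; [exact: l0|exact: m0].
have hZ : Ray V Z by rewrite ZE; exists z.
have Zz : Z z by rewrite ZE; exact: ray_refl.
split=> //; exists (weight (l *: x) z), (weight (m *: x') z).
split; [exact: weight_ghost..| |].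
  by move=> [/weight_eq0-/(_ z0)/coef0 l0 /weight_eq0-/(_ z0)/coef0 m0];
     apply: lm; split; [exact: l0|exact: m0].
move=> Y hY; have [y0 _] := Ray_mem hY (xget_Ray hY).
(* A nonzero scalar does not affect the CS-ratio; for [k = 0] both sides vanish through the
   weight. *)
have wCS k u : u <> 0 -> weight (k *: u) z * CS_vect q b (k *: u) (xget 0 Y)
    = weight (k *: u) z * CS_vect q b u (xget 0 Y).
  move=> u0; have [->|/eqP k0] := eqVneq k 0; last by rewrite CS_vectZ.
  by rewrite scale0r (weight_eq0 _ z0).2 // !mul0r.
by rewrite (CS_mem hZ Zz hY) (CS_mem hX Xx hY) (CS_mem hX' Xx' hY) CS_vectD // !wCS.
Qed.

(** The reverse types involve [CS Y2 Y1], whereas [type_cond] keeps [c12]; symmetry of the CS-ratio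
    reconciles the two. *)
Lemma LocP T Y1 Y2 W : Loc q b T Y1 Y2 W <->
  Ray V W /\ type_cond T (CS q b W Y1) (CS q b W Y2) (CS q b Y1 Y2).
Proof. by rewrite /Loc; case: T => //=; rewrite (CS_sym Y2). Qed.

Lemma Loc_partition Y1 Y2 :
  partition [set T | Loc q b T Y1 Y2 !=set0] (fun T => Loc q b T Y1 Y2) (Ray V).
Proof.
(* Nonemptiness of the blocks is built into the index set; covering and disjointness remain. *)
split=> //.
- apply/seteqP; split=> [W [T _ []]//|W hW].
  have [T hT] : exists T, type_cond T (CS q b W Y1) (CS q b W Y2) (CS q b Y1 Y2).
    by apply: type_cond_exists => //; exact: ghost_CS.
  have WT : Loc q b T Y1 Y2 W by apply/LocP.
  by exists T => //; exists W.
- move=> T T' _ _ [W [/LocP[_ h] /LocP[_ h']]].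
  have typ S := @type_cond_type_of R hR hG S _ _ _ (ghost_CS W Y1) (ghost_CS W Y2) (ghost_CS Y1 Y2).
  by rewrite -(typ _ h) -(typ _ h').
Qed.

Lemma Loc_convex T Y1 Y2 : Ray V Y1 -> Ray V Y2 -> convex (Loc q b T Y1 Y2).
Proof.
move=> hY1 hY2; split=> [W []//|X X' /LocP[hX tX] /LocP[hX' tX'] Z hZ].
have [RZ [a [a' [ha ha' nz CSE]]]] := CS_interval hX hX' hZ.
by apply/LocP; split=> //; rewrite !CSE //; apply: type_cond_comb => //; exact: ghost_CS.
Qed.

End RayRatio.

Theorem theorem5p6 (R : comPzSemiRingType) (V : lSemiModType R)
    (q : V -> R) (b : V -> V -> R)
    (hR : supertropical R) (hG : ghost_semifield R)
    (hqb : quadratic_pair q b) (hq : anisotropic q)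
    (Y1 Y2 : set V) (hY1 : Ray V Y1) (hY2 : Ray V Y2) (hY : Y1 <> Y2) :
  partition [set T : basic_type | Loc q b T Y1 Y2 !=set0]
            (fun T : basic_type => Loc q b T Y1 Y2) (Ray V) /\
  (forall T : basic_type, Loc q b T Y1 Y2 !=set0 -> convex (Loc q b T Y1 Y2)).
Proof.
split; first exact: Loc_partition.
by move=> T _; exact: Loc_convex.
Qed.
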